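(* Let $\mathcal{C}$ be a coherent configuration of rank $r$ that realizes $\bigoplus_{i=1}^k\langle \ell_i,m_i,n_i\rangle$, where $k$ and all $\ell_i,m_i,n_i$ are positive integers. Then the symmetric power $\mathrm{Sym}^k\,\mathcal{C}$ realizes $\langle \prod_{i=1}^k \ell_i,\ \prod_{i=1}^k m_i,\ \prod_{i=1}^k n_i\rangle$ and has rank $\binom{r+k-1}{k}$.
   Context: Write $[n]=\{1,\dots,n\}$. A coherent configuration of rank $r$ is a finite set $\mathcal{C}$ (of points) with a partition of $\mathcal{C}^2$ into subsets $R_1,\dots,R_r$ (nonempty, called classes) such that: (1) the diagonal $\{(x,x):x\in\mathcal{C}\}$ is a union of some of the classes; (2) for each $i\in[r]$ there is $i^*\in[r]$ with $\{(b,a):(a,b)\in R_i\}=R_{i^*}$; (3) there are integers $p^k_{i,j}$ such that for all $i,j,k\in[r]$ and all $(x,y)\in R_k$, $\#\{z\in\mathcal{C}:(x,z)\in R_i,\ (z,y)\in R_j\}=p^k_{i,j}$. Three classes $i,j,k$ form a triangle if there exist points $x,y,z$ with $(x,y)\in R_i$, $(y,z)\in R_j$, $(z,x)\in R_k$. $\mathcal{C}$ realizes $\langle\ell,m,n\rangle$ if there are injective functions $\alpha:[\ell]\times[m]\to[r]$, $\beta:[m]\times[n]\to[r]$, $\gamma:[n]\times[\ell]\to[r]$ such that $\alpha(a,b'),\beta(b,c'),\gamma(c,a')$ form a triangle iff $a=a'$, $b=b'$, $c=c'$. $\mathcal{C}$ realizes $\bigoplus_i\langle\ell_i,m_i,n_i\rangle$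 if there are injective functions $\alpha_i:[\ell_i]\times[m_i]\to[r]$, $\beta_i:[m_i]\times[n_i]\to[r]$, $\gamma_i:[n_i]\times[\ell_i]\to[r]$ such that $\alpha_i(a,b'),\beta_j(b,c'),\gamma_k(c,a')$ form a triangle iff $i=j=k$ and $a=a'$, $b=b'$, $c=c'$. The direct power $\mathcal{C}^k$ is the coherent configuration on the $k$-fold Cartesian power of the point set whose classes are indexed by $I\in[r]^k$: $((x_1,\dots,x_k),(y_1,\dots,y_k))\in R_I$ iff $(x_j,y_j)\in R_{I_j}$ for all $j$. The symmetric power $\mathrm{Sym}^k\,\mathcal{C}$ is the coherent configuration with the same points as $\mathcal{C}^k$ whose classes are the unions of the $R_I$ over the orbits of the symmetric group $S_k$ acting on $[r]^k$ by permuting coordinates. *)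

(* Defs.v *)
From mathcomp Require Import all_boot all_fingroup.

Set Implicit Arguments.
Unset Strict Implicit.
Unset Printing Implicit Defensive.

(* The classes are kept as a set of binary relations on the points; indexing
   them by [r] amounts to enumerating this set, so the rank is its cardinal. *)
Record cohConfig := CohConfig {
  point : finType;
  classes : {set {set point * point}};
  classes_partition : partition classes [set: point * point];
  classes_diag :
    exists2 D : {set {set point * point}},
      D \subset classes & cover D = [set (x, x) | x : point];
  classes_converse : forall A : {set point * point},
    A \in classes -> [set (u.2, u.1) | u in A] \in classes;
  classes_intersection :
    exists p : {set point * point} -> {set point * point} ->
               {set point * point} -> nat,
    forall A B E : {set point * point},
      A \in classes -> B \in classes -> E \in classes ->
      forall x y : point, (x, y) \in E ->
        #|[set z | ((x, z) \in A) && ((z, y) \in B)]| = p A B E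
}.

Definition cc_class (C : cohConfig) := {A : {set point C * point C} | A \in classes C}.

Definition cc_rank (C : cohConfig) : nat := #|classes C|.

Definition triangle (C : cohConfig) (A B E : cc_class C) : Prop :=
  exists x y z : point C,
    [/\ (x, y) \in val A, (y, z) \in val B & (z, x) \in val E].

Definition realizes (C : cohConfig) (l m n : nat) : Prop :=
  exists (alpha : 'I_l * 'I_m -> cc_class C)
         (beta : 'I_m * 'I_n -> cc_class C)
         (gamma : 'I_n * 'I_l -> cc_class C),
    [/\ injective alpha, injective beta, injective gamma
      & forall (a a' : 'I_l) (b b' : 'I_m) (c c' : 'I_n),
          triangle (alpha (a, b')) (beta (b, c')) (gamma (c, a')) <->
          [/\ a = a', b = b' & c = c']].

(* The indices a, a' (resp. b, b' and c, c') live in ordinal types that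
   coincide only once i = j = h, hence the comparison of their values. *)
Definition realizes_sum (C : cohConfig) (k : nat) (l m n : 'I_k -> nat) : Prop :=
  exists (alpha : forall i : 'I_k, 'I_(l i) * 'I_(m i) -> cc_class C)
         (beta : forall i : 'I_k, 'I_(m i) * 'I_(n i) -> cc_class C)
         (gamma : forall i : 'I_k, 'I_(n i) * 'I_(l i) -> cc_class C),
    [/\ forall i, injective (alpha i),
        forall i, injective (beta i),
        forall i, injective (gamma i)
      & forall (i j h : 'I_k) (a : 'I_(l i)) (b' : 'I_(m i))
               (b : 'I_(m j)) (c' : 'I_(n j)) (c : 'I_(n h)) (a' : 'I_(l h)),
          triangle (alpha i (a, b')) (beta j (b, c')) (gamma h (c, a')) <->
          (i = j /\ j = h) /\
          [/\ a = a' :> nat, b = b' :> nat & c = c' :> nat]].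

Section PermutingCoordinates.

Variables (k : nat) (A : Type).

Definition permute_coords (I : {ffun 'I_k -> A}) (s : 'S_k) : {ffun 'I_k -> A} :=
  [ffun j => I ((s^-1)%g j)].

End PermutingCoordinates.

Section CoordAction.

Variables (k : nat) (A : finType).

Lemma permute_coords1 : @permute_coords k A ^~ 1%g =1 id.
Proof. by move=> I; apply/ffunP=> j; rewrite ffunE invg1 perm1. Qed.

Lemma permute_coordsM (I : {ffun 'I_k -> A}) :
  act_morph (@permute_coords k A) I.
Proof. by move=> s t; apply/ffunP=> j; rewrite !ffunE invMg permM. Qed.

Canonical coord_action :=
  TotalAction permute_coords1 permute_coordsM.

End CoordAction.

Section SymmetricPower.

Variables (C : cohConfig) (k : nat).

Local Notation powpoint := {ffun 'I_k -> point C}.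
Local Notation cindex := {ffun 'I_k -> cc_class C}.
Local Notation orb I := (orbit (coord_action k (cc_class C)) [set: 'S_k] I).

Definition direct_power_class (I : cindex) : {set powpoint * powpoint} :=
  [set u : powpoint * powpoint | [forall j, (u.1 j, u.2 j) \in val (I j)]].

Definition sym_power_class (O : {set cindex}) : {set powpoint * powpoint} :=
  \bigcup_(I in O) direct_power_class I.

Definition sym_power_classes : {set {set powpoint * powpoint}} :=
  [set sym_power_class O
     | O in orbit (coord_action k (cc_class C)) [set: 'S_k] @: [set: cindex]].

Lemma cc_classP (u : point C * point C) : {A : cc_class C | u \in val A}.
Proof.
have covC : cover (classes C) = setT by exact: cover_partition (classes_partition C).
have uC : u \in cover (classes C) by rewrite covC inE.
pose A : cc_class C := exist _ (pblock (classes C) u) (pblock_mem uC).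
by exists A; rewrite /= mem_pblock.
Qed.

Definition color u : cc_class C := sval (cc_classP u).

Lemma colorP u (A : cc_class C) : (u \in val A) = (color u == A).
Proof.
apply/idP/eqP=> [uA | <-]; last exact: (svalP (cc_classP u)).
have /and3P[_ tiC _] := classes_partition C.
have uc : u \in val (color u) := svalP (cc_classP u).
by apply: val_inj; rewrite -(def_pblock tiC (valP _) uc) (def_pblock tiC (valP _) uA).
Qed.

Lemma cc_class_inhab (A : cc_class C) : {u | u \in val A}.
Proof.
case: (set_0Vmem (val A)) => [A0|//]; have /and3P[_ _ /negP[]] := classes_partition C.
by rewrite -A0 (valP A).
Qed.

Definition pcolor (x y : powpoint) : cindex := [ffun j => color (x j, y j)].

Lemma mem_direct x y I : ((x, y) \in direct_power_class I) = (pcolor x y == I).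
Proof.
rewrite inE; apply/forallP/eqP=> [xyI | <- j]; last by rewrite /= colorP ffunE.
by apply/ffunP=> j; rewrite ffunE; apply/eqP; rewrite -colorP xyI.
Qed.

Lemma mem_sym x y I : ((x, y) \in sym_power_class (orb I)) = (pcolor x y \in orb I).
Proof.
apply/bigcupP/idP=> [[J JI]|xyI]; first by rewrite mem_direct => /eqP->.
by exists (pcolor x y); rewrite // mem_direct.
Qed.

Lemma sym_classP S :
  reflect (exists I, S = sym_power_class (orb I)) (S \in sym_power_classes).
Proof.
apply: (iffP imsetP) => [[_ /imsetP[I _ ->] ->]|[I ->]]; first by exists I.
by exists (orb I) => //; apply: imset_f.
Qed.

Lemma pcolorX x y s :
  pcolor (permute_coords x s) (permute_coords y s) = permute_coords (pcolor x y) s.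
Proof. by apply/ffunP=> j; rewrite !ffunE. Qed.

Lemma orb_permute J I s : (permute_coords J s \in orb I) = (J \in orb I).
Proof.
have sJ : permute_coords J s \in orb J by apply/orbitP; exists s; rewrite ?inE.
apply/idP/idP=> [|JI]; last exact: orbit_trans JI.
by apply: orbit_trans; rewrite orbit_sym.
Qed.

Lemma sym_power_partition :
  partition sym_power_classes [set: powpoint * powpoint].
Proof.
apply/and3P; split.
- rewrite eqEsubset subsetT; apply/subsetP=> -[x y] _; apply/bigcupP.
  exists (sym_power_class (orb (pcolor x y))); last by rewrite mem_sym orbit_refl.
  by apply/sym_classP; exists (pcolor x y).
- apply/trivIsetP=> _ _ /sym_classP[I ->] /sym_classP[J ->] neIJ.
  apply/pred0Pn=> -[[x y] /= /andP[]]; rewrite !mem_sym.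
  by move=> /orbit_eqP eI /orbit_eqP eJ; rewrite -eI -eJ eqxx in neIJ.
- apply/sym_classP=> -[I I0].
  pose x : powpoint := [ffun j => (sval (cc_class_inhab (I j))).1].
  pose y : powpoint := [ffun j => (sval (cc_class_inhab (I j))).2].
  have: (x, y) \in sym_power_class (orb I).
    rewrite mem_sym (_ : pcolor x y = I) ?orbit_refl //.
    apply/eqP; rewrite -mem_direct inE; apply/forallP=> j; rewrite !ffunE.
    by case: (cc_class_inhab _) => -[].
  by rewrite -I0 inE.
Qed.

Lemma color_diag a b c : color (a, b) = color (c, c) -> a = b.
Proof.
move/eqP; rewrite -colorP => abc; have [D sDC defD] := classes_diag C.
have /bigcupP[A AD ccA]: (c, c) \in cover D by rewrite defD; apply: imset_f.
have eA : color (c, c) = Sub A (subsetP sDC A AD).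
  by apply/eqP; rewrite -colorP SubK.
have: (a, b) \in cover D by apply/bigcupP; exists A; rewrite // eA SubK in abc *.
by rewrite defD => /imsetP[d _ [-> ->]].
Qed.

Lemma sym_power_diag :
  exists2 D : {set {set powpoint * powpoint}},
    D \subset sym_power_classes & cover D = [set (x, x) | x : powpoint].
Proof.
exists [set sym_power_class (orb (pcolor x x)) | x : powpoint].
  by apply/subsetP=> _ /imsetP[x _ ->]; apply/sym_classP; exists (pcolor x x).
apply/setP=> -[x y]; apply/bigcupP/imsetP=> [[_ /imsetP[z _ ->]]|[z _ [-> ->]]].
  rewrite mem_sym => /orbitP[s _ /= /ffunP zxy]; exists x => //; congr pair.
  apply/esym/ffunP=> j; have:= zxy j; rewrite !ffunE => /esym; exact: color_diag.
exists (sym_power_class (orb (pcolor z z))); last by rewrite mem_sym orbit_refl.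
by apply/imsetP; exists z.
Qed.

Definition converse (A : cc_class C) : cc_class C :=
  exist (fun B => is_true (B \in classes C)) _ (classes_converse (valP A)).

Lemma color_converse a b : color (b, a) = converse (color (a, b)).
Proof.
apply/eqP; rewrite -colorP /=; apply/imsetP; exists (a, b) => //.
by rewrite colorP.
Qed.

Lemma converseK : involutive converse.
Proof.
move=> A; have [[a b] abA] := cc_class_inhab A.
by move: abA; rewrite colorP => /eqP <-; rewrite -!color_converse.
Qed.

Lemma sym_power_converse (S : {set powpoint * powpoint}) :
  S \in sym_power_classes -> [set (u.2, u.1) | u in S] \in sym_power_classes.
Proof.
case/sym_classP=> I ->; pose pconv (J : cindex) : cindex := [ffun j => converse (J j)].
have pconvK : involutive pconv by move=> J; apply/ffunP=> j; rewrite !ffunE converseK.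
have pc x y : pcolor y x = pconv (pcolor x y).
  by apply/ffunP=> j; rewrite !ffunE color_converse.
have porb J K : (pconv J \in orb (pconv K)) = (J \in orb K).
  have hom J' K' : J' \in orb K' -> pconv J' \in orb (pconv K').
    case/orbitP=> s _ <-; apply/orbitP; exists s => //.
    by apply/ffunP=> j; rewrite !ffunE.
  by apply/idP/idP; [move/hom; rewrite !pconvK | apply: hom].
apply/sym_classP; exists (pconv I); apply/setP=> -[x y]; rewrite mem_sym pc porb.
apply/imsetP/idP=> [[[y' x'] /= yxI [-> ->]]|yxI]; first by rewrite -mem_sym.
by exists (y, x); rewrite ?mem_sym.
Qed.

Lemma sym_count (I J : cindex) x y x' y' :
    pcolor x' y' \in orb (pcolor x y) ->
  #|[set z | (pcolor x z \in orb I) && (pcolor z y \in orb J)]|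
    = #|[set z | (pcolor x' z \in orb I) && (pcolor z y' \in orb J)]|.
Proof.
case/orbitP=> s _ /= exy.
pose F (u v : powpoint) :=
  #|[set z | (pcolor u z \in orb I) && (pcolor z v \in orb J)]|.
rewrite -!/(F _ _); pose xs := permute_coords x s; pose ys := permute_coords y s.
have Fs : F x y = F xs ys.
  have injs : injective ((@permute_coords k (point C))^~ s).
    exact: (act_inj (coord_action k (point C)) s).
  rewrite /F -(card_imset _ injs); apply: eq_card => z.
  rewrite -[z](actKV (coord_action k (point C)) s) /= (mem_imset _ _ injs).
  by rewrite !inE !pcolorX !orb_permute.
have {}exy : pcolor xs ys = pcolor x' y' by rewrite pcolorX.
rewrite {}Fs.
have FE u v : F u v = \sum_(K | (K.1 \in orb I) && (K.2 \in orb J))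
    foldr muln 1 [seq #|[pred c | (color (u j, c) == K.1 j)
                           && (color (c, v j) == K.2 j)]| | j : 'I_k].
  rewrite /F -sum1_card (partition_big (fun z => (pcolor u z, pcolor z v))
    (fun K => (K.1 \in orb I) && (K.2 \in orb J))) /=; last by move=> z; rewrite inE.
  apply: eq_bigr => -[K L] /= /andP[KI LJ].
  rewrite -(card_family (fun j => [pred c | (color (u j, c) == K j)
                                          && (color (c, v j) == L j)])) -sum1_card.
  apply: eq_bigl => z; rewrite !inE; apply/andP/familyP => [[_ /eqP[<- <-]] j|zKL].
    by rewrite !inE !ffunE !eqxx.
  have eK : pcolor u z = K.
    by apply/ffunP=> j; have:= zKL j; rewrite !inE ffunE => /andP[/eqP].
  have eL : pcolor z v = L.
    by apply/ffunP=> j; have:= zKL j; rewrite !inE ffunE => /andP[_ /eqP].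
  by rewrite eK eL KI LJ.
rewrite !FE; apply: eq_bigr => K _; congr foldr; apply: eq_map => j /=.
have [p pP] := classes_intersection C.
have card_p a b A B : #|[pred c | (color (a, c) == A) && (color (c, b) == B)]|
    = p (val A) (val B) (val (color (a, b))).
  rewrite -(pP _ _ _ (valP A) (valP B) (valP _) a b); last by rewrite colorP.
  by apply: eq_card => c; rewrite !inE !colorP.
by rewrite !card_p; have /ffunP/(_ j) := exy; rewrite [LHS]ffunE [RHS]ffunE => ->.
Qed.

Lemma sym_power_intersection :
  exists p : {set powpoint * powpoint} -> {set powpoint * powpoint} ->
             {set powpoint * powpoint} -> nat,
  forall A B E : {set powpoint * powpoint},
    A \in sym_power_classes -> B \in sym_power_classes ->
    E \in sym_power_classes ->
    forall x y : powpoint, (x, y) \in E ->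
      #|[set z | ((x, z) \in A) && ((z, y) \in B)]| = p A B E.
Proof.
pose rel := {set powpoint * powpoint}.
exists (fun A B E : rel => if [pick u in E] is Some u then
          #|[set z | ((u.1, z) \in A) && ((z, u.2) \in B)]| else 0).
move=> _ _ _ /sym_classP[I ->] /sym_classP[J ->] /sym_classP[K ->] x y xyK.
case: pickP => [[x' y'] /= | /(_ (x, y))]; last by rewrite xyK.
rewrite !mem_sym in xyK * => x'y'K.
have x'y'xy : pcolor x' y' \in orb (pcolor x y).
  by apply: orbit_trans x'y'K _; rewrite orbit_sym.
transitivity #|[set z | (pcolor x z \in orb I) && (pcolor z y \in orb J)]|.
  by apply: eq_card => z; rewrite !inE !mem_sym.
by rewrite (sym_count I J x'y'xy); apply: eq_card => z; rewrite !inE !mem_sym.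
Qed.

Definition sym_power : cohConfig :=
  CohConfig sym_power_partition sym_power_diag sym_power_converse
            sym_power_intersection.

End SymmetricPower.

(* Main.v *)
Require Import Defs.
From mathcomp Require Import all_boot all_fingroup.

Set Implicit Arguments.
Unset Strict Implicit.
Unset Printing Implicit Defensive.

(** Write [A_I] for the class of the symmetric power attached to the orbit of
    [I], a [k]-tuple of classes.  An index below [prod_i l_i] is read as a
    tuple [(a_1, .., a_k)] with [a_i < l_i], and the realization sends a pair
    [(a, b)] to the class [A_I] with [I i = alpha_i (a_i, b_i)]; likewise for
    [beta] and [gamma].  Three classes [A_I], [A_J], [A_K] of the symmetric
    power form a triangle exactly when, after permuting each of [I], [J], [K]
    independently, they form a triangle at every coordinate
    ([triangle_sym_class]).  For tuples coming from the direct sum, the clause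
    [i = j = h] of [realizes_sum] forces the three permutations to coincide,
    and what is left is the triangle condition of each summand: this gives
    equality of all coordinates.  The same clause shows that [alpha_i] and
    [alpha_j] have disjoint images for [i != j], so a tuple is determined by
    its orbit and the new index functions are injective
    ([sym_class_index_inj]).

    The rank is the number of orbits of ['S_k] on [k]-tuples of classes
    ([cc_rank_sym_power]), that is, of multisets of [k] classes.  Each orbit
    contains exactly one tuple that is sorted for a fixed enumeration of the
    classes, so the orbits are as many as the sorted tuples
    ([card_coord_orbits]). *)

Local Notation coord_orbit I :=
  (orbit (coord_action _ _) [set: {perm _}] I).

Section CoordOrbits.

Variables (k : nat) (A : finType).
Implicit Types (I J : {ffun 'I_k -> A}).

Lemma coord_orbitP I J :
  reflect (exists s : 'S_k, forall j, J j = I (s j)) (J \in coord_orbit I).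
Proof.
apply: (iffP orbitP) => [[s _ <-]|[s sP]].
  by exists (s^-1)%g => j; rewrite /= ffunE.
by exists (s^-1)%g; rewrite ?inE //; apply/ffunP=> j; rewrite /= ffunE invgK sP.
Qed.

(** Orbits are multisets of size [k], and each contains a unique sorted tuple
    once [A] is identified with an ordinal. *)
Lemma card_coord_orbits :
  0 < #|A| ->
  #|[set coord_orbit I | I in [set: {ffun 'I_k -> A}]]| = 'C(#|A| + k - 1, k).
Proof.
case eA: #|A| => [//|r] _; rewrite addSn subSS subn0 addnC.
pose g (i : 'I_r.+1) : A := enum_val (cast_ord (esym eA) i).
have g_inj : injective g by move=> i j /enum_val_inj/cast_ord_inj.
pose h (x : A) : 'I_r.+1 := cast_ord eA (enum_rank x).
have hK : cancel h g by move=> x; rewrite /g cast_ordK enum_rankK.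
pose f (t : k.-tuple 'I_r.+1) : {ffun 'I_k -> A} := [ffun j => g (tnth t j)].
have orb_perm t u : (f t \in coord_orbit (f u)) = perm_eq t u.
  apply/coord_orbitP/tuple_permP=> -[s sP]; exists s; last first.
    move=> j; rewrite !ffunE; congr g.
    by rewrite (tnth_nth ord0 t) sP -(tnth_nth ord0) tnth_mktuple.
  congr tval; apply: eq_from_tnth => j; rewrite tnth_mktuple; apply: g_inj.
  by have := sP j; rewrite !ffunE.
rewrite -card_sorted_tuples.
have le_trans : transitive (relpre val leq : rel 'I_r.+1).
  by move=> ? ? ?; apply: leq_trans.
have le_anti : antisymmetric (relpre val leq : rel 'I_r.+1).
  by move=> i j /anti_leq/val_inj.
have le_total : total (relpre val leq : rel 'I_r.+1).
  by move=> i j; apply: leq_total.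
rewrite -(card_in_imset (f := fun t => coord_orbit (f t))); last first.
  move=> t u; rewrite !inE !sorted_map => t_le u_le /orbit_eqP.
  by rewrite orb_perm => /(sorted_eq le_trans le_anti t_le u_le)/val_inj.
apply: eq_card => O; apply/imsetP/imsetP=> [[I _ ->]|[t _ ->]]; last first.
  by exists (f t).
pose t := [tuple h (I j) | j < k]; exists (sort_tuple (relpre val leq) t).
  by rewrite inE sorted_map sort_sorted.
have -> : I = f t by apply/ffunP=> j; rewrite ffunE tnth_mktuple hK.
by apply/orbit_eqP; rewrite orb_perm perm_sym perm_sort.
Qed.

End CoordOrbits.

Section SymClass.

Variables (C : cohConfig) (k : nat).
Implicit Types (I J K : {ffun 'I_k -> cc_class C}).

Lemma sym_class_subproof I :
  sym_power_class (coord_orbit I) \in Defs.classes (sym_power C k).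
Proof. by apply/sym_classP; exists I. Qed.

Definition sym_class I : cc_class (sym_power C k) :=
  exist (fun B => is_true (B \in Defs.classes (sym_power C k))) _
        (sym_class_subproof I).

(** No class of the direct power is empty; this is what lets a class of the
    symmetric power determine its orbit. *)
Lemma pcolor_surj I : exists x y : {ffun 'I_k -> point C}, pcolor x y = I.
Proof.
pose u j := sval (cc_class_inhab (I j)).
have uP j : u j \in val (I j) by apply: svalP (cc_class_inhab (I j)).
exists [ffun j => (u j).1], [ffun j => (u j).2]; apply/ffunP=> j; rewrite !ffunE.
by apply/eqP; rewrite -colorP -surjective_pairing.
Qed.

Lemma sym_power_class_inj I J :
  sym_power_class (coord_orbit I) = sym_power_class (coord_orbit J) ->
  I \in coord_orbit J.
Proof.
have [x [y xyI]] := pcolor_surj I.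
by move/setP/(_ (x, y)); rewrite !mem_sym xyI orbit_refl.
Qed.

Lemma cc_rank_sym_power :
  cc_rank (sym_power C k) =
    #|[set coord_orbit I | I in [set: {ffun 'I_k -> cc_class C}]]|.
Proof.
apply: card_in_imset => _ _ /imsetP[I _ ->] /imsetP[J _ ->].
by move/sym_power_class_inj/orbit_eqP.
Qed.

Lemma mem_sym_class (x y : {ffun 'I_k -> point C}) I :
  reflect (exists s : 'S_k, forall j, (x j, y j) \in val (I (s j)))
          ((x, y) \in val (sym_class I)).
Proof.
rewrite [_ \in _]mem_sym; apply: (iffP (coord_orbitP I _)) => -[s sP]; exists s => j.
  by rewrite colorP -sP ffunE.
by apply/eqP; rewrite ffunE -colorP.
Qed.

(** Each side of a triangle in the symmetric power only fixes the tuple of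
    colors up to its own permutation; conversely the points of the triangles
    found at the separate coordinates assemble into points of the power. *)
Lemma triangle_sym_class I J K :
  triangle (sym_class I) (sym_class J) (sym_class K) <->
  exists s t u : 'S_k, forall j, triangle (I (s j)) (J (t j)) (K (u j)).
Proof.
split=> [[x [y [z []]]]|[s [t [u]]]].
  move=> /mem_sym_class[s sP] /mem_sym_class[t tP] /mem_sym_class[u uP].
  by exists s, t, u => j; exists (x j), (y j), (z j).
case/fin_all_exists=> x /fin_all_exists[y] /fin_all_exists[z xyzP].
exists [ffun j => x j], [ffun j => y j], [ffun j => z j].
by split; apply/mem_sym_class;
  [exists s | exists t | exists u] => j; rewrite !ffunE; case: (xyzP j).
Qed.

(** Disjointness of the images makes the index [i] readable off the class
    [F i p], so that the only permutation relating two tuples of this form is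
    the identity. *)
Lemma sym_class_index_inj (X Y : Type) (U V : 'I_k -> finType)
    (dU : X -> {dffun forall i, U i}) (dV : Y -> {dffun forall i, V i})
    (F : forall i, U i * V i -> cc_class C) :
  injective dU -> injective dV ->
  (forall i, injective (F i)) -> (forall i j p q, F i p = F j q -> i = j) ->
  injective (fun p : X * Y => sym_class [ffun i => F i (dU p.1 i, dV p.2 i)]).
Proof.
move=> dU_inj dV_inj F_inj F_disj [a b] [a' b'] /(congr1 val)/sym_power_class_inj.
case/coord_orbitP=> s sP.
have {sP} abP i : (dU a i, dV b i) = (dU a' i, dV b' i).
  have := sP i; rewrite !ffunE /= => eF; apply: F_inj.
  by move: (eF); rewrite -(F_disj _ _ _ _ eF).
by congr pair; [apply: dU_inj | apply: dV_inj]; apply/ffunP=> i; case: (abP i).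
Qed.

End SymClass.

Lemma prod_coordinates (k : nat) (l : 'I_k -> nat) :
  exists d : 'I_(\prod_(i < k) l i) -> {dffun forall i, 'I_(l i)}, injective d.
Proof.
have card_l : \prod_(i < k) l i = #|{dffun forall i, 'I_(l i)}|.
  rewrite card_dep_ffun foldrE big_map big_enum /=.
  by apply: eq_bigr => i _; rewrite card_ord.
exists (fun a => enum_val (cast_ord card_l a)).
by move=> a b /enum_val_inj/cast_ord_inj.
Qed.

Lemma realizes_sym_power (C : cohConfig) (k : nat) (l m n : 'I_k -> nat) :
  (forall i, 0 < l i) -> (forall i, 0 < m i) -> (forall i, 0 < n i) ->
  realizes_sum C l m n ->
  realizes (sym_power C k) (\prod_(i < k) l i) (\prod_(i < k) m i)
           (\prod_(i < k) n i).
Proof.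
move=> l_gt0 m_gt0 n_gt0 [alpha [beta [gamma [alphaI betaI gammaI triP]]]].
have tri i a b c : triangle (alpha i (a, b)) (beta i (b, c)) (gamma i (c, a)).
  by apply/triP.
(* Complete one of the two equal classes to a triangle of its own summand; the
   other class then lies in that triangle too.  The third index needed for this
   exists by positivity of the dimensions. *)
have alphaD i j p q : alpha i p = alpha j q -> i = j.
  case: p q => [a b] [a' b'] eq_ij; have := tri j a' b' (Ordinal (n_gt0 j)).
  by rewrite -eq_ij => /triP[[]].
have betaD i j p q : beta i p = beta j q -> i = j.
  case: p q => [b c] [b' c'] eq_ij; have := tri j (Ordinal (l_gt0 j)) b' c'.
  by rewrite -eq_ij => /triP[[]].
have gammaD i j p q : gamma i p = gamma j q -> i = j.
  case: p q => [c a] [c' a'] eq_ij; have := tri j a' (Ordinal (m_gt0 j)) c'.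
  by rewrite -eq_ij => /triP[[]].
have [dl dlI] := prod_coordinates l.
have [dm dmI] := prod_coordinates m.
have [dn dnI] := prod_coordinates n.
exists (fun p => sym_class [ffun i => alpha i (dl p.1 i, dm p.2 i)]).
exists (fun p => sym_class [ffun i => beta i (dm p.1 i, dn p.2 i)]).
exists (fun p => sym_class [ffun i => gamma i (dn p.1 i, dl p.2 i)]).
split.
- exact: (sym_class_index_inj dlI dmI).
- exact: (sym_class_index_inj dmI dnI).
- exact: (sym_class_index_inj dnI dlI).
move=> a a' b b' c c'.
split=> [/triangle_sym_class[s [t [u stu]]]|[<- <- <-]]; last first.
  apply/triangle_sym_class.
  by exists 1%g, 1%g, 1%g => j; rewrite !ffunE perm1; apply: tri.
have eq_st : s = t by apply/permP=> j; have := stu j; rewrite !ffunE => /triP[[]].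
have eq_tu : t = u by apply/permP=> j; have := stu j; rewrite !ffunE => /triP[[]].
(* The common permutation [s] need not be trivial: coordinate [i] of the indices
   is seen at coordinate [s^-1 i] of the points. *)
have abc i : [/\ dl a i = dl a' i, dm b i = dm b' i & dn c i = dn c' i].
  have := stu ((s^-1)%g i); rewrite -eq_tu -eq_st permKV !ffunE /=.
  by case/triP=> _ [/val_inj ea /val_inj eb /val_inj ec].
by split; [apply: dlI | apply: dmI | apply: dnI]; apply/ffunP=> i; case: (abc i).
Qed.

Theorem theorem5p3 (C : cohConfig) (r k : nat) (l m n : 'I_k -> nat)
    (k_gt0 : 0 < k)
    (l_gt0 : forall i, 0 < l i) (m_gt0 : forall i, 0 < m i)
    (n_gt0 : forall i, 0 < n i)
    (rankC : cc_rank C = r) (realC : realizes_sum C l m n) :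
  realizes (sym_power C k) (\prod_(i < k) l i) (\prod_(i < k) m i)
           (\prod_(i < k) n i) /\
  cc_rank (sym_power C k) = 'C(r + k - 1, k).
Proof.
split; first exact: realizes_sym_power.
have card_classes : #|{: cc_class C}| = r by rewrite card_sig.
rewrite cc_rank_sym_power -card_classes; apply: card_coord_orbits.
have [alpha _] := realC; pose i := Ordinal k_gt0.
by apply/card_gt0P; exists (alpha i (Ordinal (l_gt0 i), Ordinal (m_gt0 i))).
Qed.
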